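(* Let $n\ge 1$, let $\Omega$ be a nonempty open subset of $\mathbb{R}^n\times\mathbb{R}$, with variable denoted $(x,y)$, where $x=(x_1,\dots,x_n)\in\mathbb{R}^n$ and $y\in\mathbb{R}$. Let $F:\Omega\to\mathbb{R}$ be differentiable (at every point of $\Omega$), with $\frac{\partial F}{\partial y}$ nowhere vanishing on $\Omega$, and let $(a,b)$ be a point in $\Omega$ such that $F(a,b)=0$. Then there exists an open set $X\times Y$ (with $X\subseteq\mathbb{R}^n$ and $Y\subseteq\mathbb{R}$), contained in $\Omega$ and containing the point $(a,b)$, that satisfies the following. (1) There exists a unique function $g:X\to Y$ that satisfies $F(x,g(x))=0$ for all $x$ in $X$. (2) We have $g(a)=b$. The function $g:X\to Y$ is differentiable and satisfies $$\frac{\partial g}{\partial x_j}(x)=-\frac{\frac{\partial F}{\partial x_j}(x,g(x))}{\frac{\partial F}{\partial y}(x,g(x))},\quad\text{for all } x \text{ in } X,\ \text{where } j=1,\dots,n.$$ Moreover, if $\nabla F(x,y)$ is continuous at $(a,b)$, then $\nabla g(x)$ is continuous at $x=a$.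
   Context: Differentiable means (Fréchet) differentiable at every point of the domain; the partial derivatives are not assumed continuous. $\nabla F$ denotes the gradient (vector of first-order partial derivatives), regarded as a function on the domain. A product set $X\times Y$ is open if and only if $X$ and $Y$ are open. *)

(* Defs.v *)
From HB Require Import structures.
From mathcomp Require Export all_boot all_order all_algebra.
From mathcomp Require Export all_classical all_reals all_analysis.

Set Implicit Arguments.
Unset Strict Implicit.
Unset Printing Implicit Defensive.

Export Order.TTheory GRing.Theory Num.Theory.
Export numFieldNormedType.Exports.

#[global] Open Scope ring_scope.
#[global] Open Scope classical_set_scope.

(* Functions with an open domain (F on Omega, g on X) are represented by total
   functions.  Differentiability, partial derivatives and continuity are only
   asserted at points of the domain; these notions are local, so, the domain
   being open, the values outside of it are irrelevant. *)

Section partial_derivatives.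
Context {R : realType} {n : nat}.

Definition partial (g : 'rV[R]_n -> R) (j : 'I_n) (x : 'rV[R]_n) : R :=
  'D_(delta_mx 0 j : 'rV[R]_n) g x.

Definition gradient (g : 'rV[R]_n -> R) (x : 'rV[R]_n) : 'rV[R]_n :=
  \row_(j < n) partial g j x.

Definition partial_x (F : 'rV[R]_n * R -> R) (j : 'I_n) (p : 'rV[R]_n * R) : R :=
  'D_((delta_mx 0 j, 0) : 'rV[R]_n * R) F p.

Definition partial_y (F : 'rV[R]_n * R -> R) (p : 'rV[R]_n * R) : R :=
  'D_((0, 1) : 'rV[R]_n * R) F p.

(* R^(n+1) is identified with R^n x R. *)
Definition gradient_xy (F : 'rV[R]_n * R -> R) (p : 'rV[R]_n * R) :
    'rV[R]_n * R :=
  (\row_(j < n) partial_x F j p, partial_y F p).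

End partial_derivatives.

Definition implicit_solution (R : realType) (n : nat) (F : 'rV[R]_n * R -> R)
    (X : set 'rV[R]_n) (Y : set R) (g : 'rV[R]_n -> R) : Prop :=
  set_fun X Y g /\ forall x, X x -> F (x, g x) = 0.

(* Main.v *)
Require Import Defs.
From HB Require Import structures.
From mathcomp Require Import lra.

(** The contraction principle does not apply, since the derivative of [F] need
not be continuous.  What replaces it is order: the unknown [y] is a single real
variable.

On a vertical segment {x} x [c, d] along which the partial derivative in [y]
does not vanish, Rolle's theorem makes [y |-> F (x, y)] injective
([slice_injective]).  An injective continuous function of one real variable is
strictly monotone, so at a zero [b] of [F (a, .)] the values [F (a, b - e)]
and [F (a, b + e)] have opposite signs ([sign_change]).  As [F] is continuous
at these two points, the signs stay opposite for all [x] near [a], and the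
intermediate value theorem gives a zero of [F (x, .)] within [e] of [b], unique
by injectivity ([near_unique_zero]).  This holds for all small [e > 0].

One such [e] yields the solution [g] and its uniqueness.  The same lemma,
applied with arbitrarily small [e] at each point [(x, g x)] of the graph,
yields the continuity of [g]: the zeros that it locates near [g x] can only be
values of [g].

Once [g] is known to be continuous, differentiability follows from the
first-order expansion of [F] at the single point [(x, g x)]
([is_diff_implicit]), which again needs no regularity of the derivative.
Everything up to there is valid with an arbitrary normed space [V] in place of
R^n ([implicit_function]).  The formula for the gradient of [g] then transfers
the continuity of the gradient of [F]. *)

Section implicit_function.
Set Implicit Arguments.
Unset Strict Implicit.
Unset Printing Implicit Defensive.
Context {R : realType} {V : normedModType R}.
Implicit Types (F : V * R -> R) (x a : V) (y b : R).

(** * Functions on vertical segments *)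

(** [cvg_pair] for limits that are points: stating the limit as a point of the
product lets unification find the two filters. *)
Lemma cvg_to_point_pair {T : Type} {U W : nbhsType} (A : set_system T) (f : T -> U)
    (g : T -> W) (u : U) (w : W) : Filter A ->
  Filter (nbhs u) -> Filter (nbhs w) ->
  f @ A --> u -> g @ A --> w -> (f t, g t) @[t --> A] --> (u, w).
Proof. by move=> FA Fu Fw; exact: cvg_pair. Qed.

Lemma is_derive_slice F x y : differentiable F (x, y) ->
  is_derive y (1 : R) (fun t => F (x, t)) ('D_((0, 1) : V * R) F (x, y)).
Proof.
move=> dF.
have quotientE : (fun h : R => h^-1 *: (((fun t => F (x, t)) \o shift y) (h *: 1)
      - F (x, y))) =
    (fun h => h^-1 *: ((F \o shift (x, y)) (h *: ((0, 1) : V * R)) - F (x, y))).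
  apply/funext => h /=.
  by rewrite [X in F X](_ : _ = (h *: 0 + x, h *: 1 + y)) // scaler0 add0r.
by split; [rewrite /derivable quotientE; exact: diff_derivable
          |rewrite /derive quotientE].
Qed.

Lemma graph_continuous (g : V -> R) a : {for a, continuous g} ->
  {for a, continuous (fun x => (x, g x))}.
Proof. by move=> g_cont; apply: cvg_to_point_pair; [exact: cvg_id|exact: g_cont]. Qed.

Lemma slice_continuous F x (c d : R) :
  (forall y, y \in `[c, d]%R -> differentiable F (x, y)) ->
  {within `[c, d], continuous (fun t => F (x, t))}.
Proof.
by move=> dF; apply: derivable_within_continuous => y /dF/is_derive_slice[].
Qed.

(** Two equal values would force, by Rolle's theorem, a zero of the partial
derivative in between. *)
Lemma slice_injective F x (c d : R) :
  (forall y, y \in `[c, d]%R ->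
     differentiable F (x, y) /\ 'D_((0, 1) : V * R) F (x, y) <> 0) ->
  {in `[c, d]%R &, injective (fun t => F (x, t))}.
Proof.
move=> F_good.
suff no_repeat y1 y2 : y1 \in `[c, d]%R -> y2 \in `[c, d]%R -> y1 < y2 ->
    F (x, y1) <> F (x, y2).
  by move=> y1 y2 y1cd y2cd Fy12; case: (ltgtP y1 y2) => // lty;
    [case: (no_repeat y1 y2)|case: (no_repeat y2 y1)].
move=> y1cd y2cd lty Fy12.
have itv_sub y : y \in `[y1, y2]%R -> y \in `[c, d]%R.
  move: y1cd y2cd; rewrite !in_itv /= => /andP[cy1 _] /andP[_ y2d] /andP[y1y yy2].
  by rewrite (le_trans cy1) //= (le_trans yy2).
have [|||z zy12 dFz] := @Rolle R (fun t => F (x, t)) y1 y2 lty.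
- by move=> y /subset_itv_oo_cc/itv_sub/F_good[/is_derive_slice[]].
- by apply: slice_continuous => y /itv_sub/F_good[].
- exact: Fy12.
have [dF Fy0] := F_good _ (itv_sub _ (subset_itv_oo_cc zy12)).
by apply: Fy0; have [_ <-] := is_derive_slice dF; have [_ ->] := dFz.
Qed.

(** An injective continuous function on a segment is strictly monotone, hence
changes sign at an interior zero. *)
Lemma sign_change (f : R -> R) (c b d : R) : c < b -> b < d ->
  {within `[c, d], continuous f} -> {in `[c, d]%R &, injective f} -> f b = 0 ->
  f c * f d < 0.
Proof.
move=> cb bd f_cont f_inj fb0.
have bcd : b \in `[c, d]%R by rewrite in_itv /= !ltW.
have ccd : c \in `[c, d]%R by rewrite in_itv /= lexx ltW // (lt_trans cb).
have dcd : d \in `[c, d]%R by rewrite in_itv /= lexx andbT ltW // (lt_trans cb).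
have [mono|mono] := itv_continuous_inj_mono f_cont f_inj.
- have fc : f c < 0 by rewrite -fb0 mono.
  by rewrite nmulr_rlt0 // -fb0 mono.
- have fc : 0 < f c by rewrite -fb0 mono.
  by rewrite pmulr_rlt0 // -fb0 mono.
Qed.

(** * Zeros near a given zero *)

(** The statement holds for all small [e], not just one: a fixed [e] defines
the implicit function, letting [e] tend to 0 shows its continuity. *)
Lemma near_unique_zero F a b :
  (\forall p \near (a, b), differentiable F p /\ 'D_((0, 1) : V * R) F p <> 0) ->
  F (a, b) = 0 ->
  \forall e \near 0^'+, \forall x \near a,
    exists! y, ball b e y /\ F (x, y) = 0.
Proof.
move=> /nbhs_ballP[r /= r0 F_good] Fab0.
near=> e.
have e0 : 0 < e by near: e; exact: nbhs_right_gt.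
have er : e < r by near: e; exact: nbhs_right_lt.
have good x y : ball a r x -> y \in `[b - e, b + e]%R ->
    differentiable F (x, y) /\ 'D_((0, 1) : V * R) F (x, y) <> 0.
  move=> xr; rewrite in_itv /= -ler_distlC => ye; apply: F_good; split => //=.
  by rewrite -ball_normE /=; apply: le_lt_trans er.
have inj x : ball a r x -> {in `[b - e, b + e]%R &, injective (fun t => F (x, t))}.
  by move=> xr; apply: slice_injective => y /(good _ _ xr).
have cont x : ball a r x -> {within `[b - e, b + e], continuous (fun t => F (x, t))}.
  by move=> xr; apply: slice_continuous => y /(good _ _ xr)[].
have lo : b - e \in `[b - e, b + e]%R by rewrite in_itv /= lexx; lra.
have hi : b + e \in `[b - e, b + e]%R by rewrite in_itv /= lexx andbT; lra.
have aa : ball a r a by exact: ballxx.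
have prod_lt0 : F (a, b - e) * F (a, b + e) < 0.
  by apply: (@sign_change (fun t => F (a, t)) _ b); [lra|lra|exact: cont|exact: inj|].
have Fcvg y : y \in `[b - e, b + e]%R -> F (x, y) @[x --> a] --> F (a, y).
  move=> ye; have [dF _] := good _ _ aa ye.
  have xy_cvg : (x, y) @[x --> a] --> (a, y).
    by apply: cvg_to_point_pair; [exact: cvg_id|exact: cvg_cst].
  exact: (cvg_comp _ _ xy_cvg (differentiable_continuous dF)).
(* The two endpoint values depend continuously on [x], so they keep their
   opposite signs. *)
have sgn_near : \forall x \near a, F (x, b - e) * F (x, b + e) < 0.
  exact: (cvgr_lt _ (cvgM (Fcvg _ lo) (Fcvg _ hi))).
near=> x.
have xr : ball a r x by near: x; exact: nbhsx_ballx.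
have sgn : F (x, b - e) * F (x, b + e) < 0 by near: x.
have [||y ye Fy] := @IVT R (fun t => F (x, t)) (b - e) (b + e) 0 _ (cont _ xr).
- by lra.
- rewrite ge_min le_max.
  case: (ltgtP (F (x, b - e)) 0) sgn => //= s;
    by case: (ltgtP (F (x, b + e)) 0) => //=; nra.
have ball_itv z : ball b e z -> z \in `[b - e, b + e]%R.
  by rewrite -ball_normE /= in_itv /= -ler_distlC => /ltW.
exists y; split; last first.
  by move=> z [/ball_itv ze Fz]; apply: (inj _ xr) => //; rewrite Fy.
(* The intermediate value theorem gives a zero in the closed segment; the
   endpoints are excluded because the values there have opposite signs. *)
split=> //; rewrite -ball_normE /= ltr_distlC.
move: ye; rewrite in_itv /= => /andP[lo_y y_hi].
have lo_neq : b - e != y.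
  by apply: contraTneq sgn => ->; rewrite Fy mul0r ltxx.
have hi_neq : y != b + e.
  by apply: contraTneq sgn => <-; rewrite Fy mulr0 ltxx.
by rewrite !lt_neqAle lo_neq hi_neq lo_y y_hi.
Unshelve. all: by end_near. Qed.

(** * Differentiating the implicit function *)

(** Where the partial derivative in [y] is nonzero, this is the solution [k] of
the linearised equation ['d F p (h, k) = 0]. *)
Definition implicit_differential F (p : V * R) (h : V) : R :=
  - (('D_((0, 1) : V * R) F p)^-1 * 'd F p (h, 0)).

Lemma implicit_differential_is_linear F p : linear (implicit_differential F p).
Proof.
move=> k u v; rewrite /implicit_differential.
have -> : (k *: u + v, 0) = k *: (u, 0) + (v, 0) :> V * R.
  by rewrite [RHS](_ : _ = (k *: u + v, k *: 0 + 0)) // scaler0 addr0.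
rewrite linearP mulrDr opprD; congr (_ - _).
by rewrite scalerN; congr (- _); rewrite /= mulrCA.
Qed.

HB.instance Definition _ F p := GRing.isLinear.Build R V R *:%R
  (implicit_differential F p) (implicit_differential_is_linear F p).

Lemma implicit_differential_continuous F p : differentiable F p ->
  continuous (implicit_differential F p).
Proof.
move=> dF h; apply: cvgN; apply: cvgMl_tmp.
have h0_cvg : (k, 0 : R) @[k --> h] --> (h, 0 : R).
  by apply: cvg_to_point_pair; [exact: cvg_id|exact: cvg_cst].
have dF_cont : {for (h, 0 : R), continuous ('d F p)} by exact: diff_continuous.
exact: (cvg_comp (fun k => (k, 0)) ('d F p) h0_cvg dF_cont).
Qed.

(** Write [k] for the increment of [g] along [h], [c] for the partial derivative
in [y], and [D] for the implicit differential.  As [F] is constant along the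
graph, its expansion gives ['d F (h, k) = o(|h| + |k|)], and the left-hand side
is [c (k - D h)].  So [k - D h = o(|h| + |k|)]; since [D] is bounded, this first
forces [k = O(h)] and then [k - D h = o(h)].  The continuity of [g] is what
makes the expansion of [F] applicable to [(h, k)]. *)
Lemma is_diff_implicit F (g : V -> R) a :
  differentiable F (a, g a) -> 'D_((0, 1) : V * R) F (a, g a) <> 0 ->
  {for a, continuous g} ->
  (\forall x \near a, F (x, g x) = F (a, g a)) ->
  is_diff a g (implicit_differential F (a, g a)).
Proof.
move=> dF /eqP c0 g_cont gF.
set p := (a, g a); set D := implicit_differential F p.
have D_cont : continuous D by exact: implicit_differential_continuous.
suff expansion : g \o shift a = cst (g a) + D +o_ 0 id.
  have dg := diff_unique D_cont expansion.
  split; [apply/diff_locallyP; rewrite dg; split => //|exact: dg].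
have [M M0 DM] := linear_lipschitz D_cont.
have [_ /eqaddoP F_exp] := (diff_locallyP _ _).1 dF.
apply/eqaddoP => eps eps0.
pose c := 'D_((0, 1) : V * R) F p.
(* The bound [eta <= 1/2] lets the left-hand side absorb the term in [|k|] of
   [|k| <= M |h| + eta (|h| + |k|)], which gives [|h| + |k| <= (2 M + 2) |h|];
   the other bound then yields [eps]. *)
pose eta := Num.min 2^-1 (eps / (2 * M + 2)).
have eta0 : 0 < eta by rewrite lt_min; apply/andP; split; [lra|apply: divr_gt0; lra].
have dl0 : 0 < eta * `|c| by rewrite mulr_gt0 // normr_gt0.
have shift_cvg : h + a @[h --> (0 : V)] --> a.
  by rewrite -[a in X in _ --> X]add0r; apply: cvgD; [exact: cvg_id|exact: cvg_cst].
have g_shift_cvg : g (h + a) @[h --> (0 : V)] --> g a.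
  exact: (cvg_comp (fun h => h + a) g shift_cvg g_cont).
have k_cvg : g (h + a) - g a @[h --> (0 : V)] --> 0.
  by rewrite -(subrr (g a)); apply: cvgB => //; exact: cvg_cst.
have incr_cvg : (h, g (h + a) - g a) @[h --> (0 : V)] --> (0 : V * R).
  by apply: cvg_to_point_pair; [exact: cvg_id|exact: k_cvg].
have F_le : \forall h \near (0 : V),
    `|(F \o shift p - (cst (F p) + 'd F p)) (h, g (h + a) - g a)|
    <= eta * `|c| * `|(h, g (h + a) - g a)|.
  exact: (incr_cvg _ (F_exp _ dl0)).
have F_const : \forall h \near (0 : V), F (h + a, g (h + a)) = F p.
  exact: (shift_cvg _ gF).
near=> h.
have Fh : F (h + a, g (h + a)) = F p by near: h.
have : `|(F \o shift p - (cst (F p) + 'd F p)) (h, g (h + a) - g a)|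
    <= eta * `|c| * `|(h, g (h + a) - g a)| by near: h.
set k := g (h + a) - g a.
rewrite (_ : (F \o shift p - (cst (F p) + 'd F p)) (h, k) = - (c * (k - D h))).
  rewrite normrN normrM mulrAC [_ * `|c|]mulrC ler_pM2l ?normr_gt0 // => k_D_le.
  have hk_le : `|(h, k)| <= `|h| + `|k|.
    by rewrite prod_normE ge_max lerDl lerDr !normr_ge0.
  have Dh_le := DM h.
  have k_le : `|k| <= `|k - D h| + `|D h| by rewrite -{1}(subrK (D h) k) ler_normD.
  have -> : (g \o shift a - (cst (g a) + D)) h = k - D h.
    by rewrite opprD addrA.
  have eta_half : eta <= 2^-1 by rewrite ge_min lexx.
  have eta_eps : eta * (2 * M + 2) <= eps.
    by rewrite -ler_pdivlMr ?ge_min ?lexx ?orbT //; lra.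
  have h0 := normr_ge0 h; have k0 := normr_ge0 k.
  move: h0 k0 k_D_le hk_le Dh_le k_le eta_half eta_eps.
  set A := `|k - D h|; set B := `|(h, k)|; set C := `|k|.
  set E := `|D h|; set H := `|h|.
  move=> h0 k0 k_D_le hk_le Dh_le k_le eta_half eta_eps.
  have A_le : A <= eta * (H + C) by apply: le_trans k_D_le _; rewrite ler_pM2l.
  have HC_le : H + C <= (2 * M + 2) * H.
    have : eta * (H + C) <= 2^-1 * (H + C) by rewrite ler_wpM2r // addr_ge0.
    by nra.
  apply: le_trans A_le _; apply: le_trans (ler_wpM2r h0 eta_eps).
  by rewrite -mulrA ler_pM2l.
have cE : 'd F p (0, 1) = c by rewrite /c deriveE.
have DhE : c * D h = - 'd F p (h, 0).
  by rewrite /D /implicit_differential mulrN mulrA divff // mul1r.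
have -> : c * (k - D h) = 'd F p (h, k).
  have -> : (h, k) = (h, 0) + k *: (0, 1).
    by rewrite [RHS](_ : _ = (h + k *: 0, 0 + k * 1)) // scaler0 addr0 add0r mulr1.
  by rewrite linearD linearZ /= cE mulrBr DhE opprK addrC mulrC.
rewrite [LHS](_ : _ = F (h + a, k + g a) - (F p + 'd F p (h, k))) //.
by rewrite subrK Fh opprD addrA subrr add0r.
Unshelve. all: by end_near. Qed.

(** * The implicit function *)

(** [X] is the interior of the set of those [x] near [a] for which [F (x, .)]
has exactly one zero in the ball [Y] around [b]. *)
Lemma implicit_function (Omega : set (V * R)) (F : V * R -> R) (a : V) (b : R) :
  open Omega -> (forall p, Omega p -> differentiable F p) ->
  (forall p, Omega p -> 'D_((0, 1) : V * R) F p <> 0) ->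
  Omega (a, b) -> F (a, b) = 0 ->
  exists (X : set V) (Y : set R) (g : V -> R),
    [/\ open X, open Y, X `*` Y `<=` Omega, X a & Y b] /\
    (forall x, X x -> [/\ Y (g x), F (x, g x) = 0,
       forall y, Y y -> F (x, y) = 0 -> y = g x,
       {for x, continuous g} &
       is_diff x g (implicit_differential F (x, g x))]).
Proof.
move=> Omega_open F_diff Fy_neq0 Omega_ab F_ab.
pose good p := differentiable F p /\ 'D_((0, 1) : V * R) F p <> 0.
have Omega_good p : Omega p -> \forall q \near p, good q.
  move=> Op; apply: filterS (open_nbhs_nbhs (conj Omega_open Op)) => q Oq.
  by split; [exact: F_diff|exact: Fy_neq0].
have /nbhs_ballP[r /= r0 r_Omega] : nbhs (a, b) Omega by exact: open_nbhs_nbhs.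
have [e [e0 er uniq_near]] : exists e, [/\ 0 < e, e < r &
    \forall x \near a, exists! y, ball b e y /\ F (x, y) = 0].
  near (0 : R)^'+ => e; exists e; split; [by []|by []|].
  by near: e; exact: near_unique_zero (Omega_good _ Omega_ab) F_ab.
pose W := [set x | ball a r x /\ exists! y, ball b e y /\ F (x, y) = 0].
have W_a : nbhs a W by apply: filterI => //; exact: nbhsx_ballx.
pose X := W^°; pose Y := ball b e.
have XW x : X x -> W x by exact: interior_subset.
have zeroP x : exists y, W x -> [/\ Y y, F (x, y) = 0 &
    forall z, Y z -> F (x, z) = 0 -> z = y].
  have [[_ [y [[Yy Fy] y_uniq]]]|nWx] := pselect (W x); last by exists 0.
  by exists y => _; split=> // z Yz Fz; rewrite (y_uniq z).
have /choice[g g_spec] := zeroP.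
have XY_Omega : X `*` Y `<=` Omega.
  move=> [x y] [/= /XW[xr _] ye]; apply: r_Omega; split=> //=.
  by apply: le_ball ye; exact: ltW.
have gY x : X x -> Y (g x) by move=> /XW/g_spec[].
have Fg x : X x -> F (x, g x) = 0 by move=> /XW/g_spec[].
have g_uniq x y : X x -> Y y -> F (x, y) = 0 -> y = g x.
  by move=> /XW/g_spec[_ _]; apply.
have Og x : X x -> Omega (x, g x).
  by move=> Xx; apply: XY_Omega; split=> //=; exact: gY.
have X_open : open X by exact: open_interior.
have Y_open : open Y by exact: ball_open.
have Xnear x : X x -> \forall x' \near x, X x' by move=> Xx; exact: open_nbhs_nbhs.
(* For small [d], the zero of [F (x', .)] within [d] of [g x] lies in [Y], hence
   it is [g x']. *)
have g_cont x : X x -> {for x, continuous g}.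
  move=> Xx; apply/cvgrPdist_lt => eps eps0.
  have /nbhs_ballP[s /= s0 sY] : nbhs (g x) Y.
    by apply: open_nbhs_nbhs; split=> //; exact: gY.
  have [d [d0 d_eps ds uniq_d]] : exists d, [/\ 0 < d, d < eps, d < s &
      \forall x' \near x, exists! y, ball (g x) d y /\ F (x', y) = 0].
    near (0 : R)^'+ => d; exists d; split; [by []|by []|by []|].
    by near: d; exact: near_unique_zero (Omega_good _ (Og _ Xx)) (Fg _ Xx).
  near=> x'.
  have Xx' : X x' by near: x'; exact: Xnear.
  have [y [[yd Fy] _]] : exists! y, ball (g x) d y /\ F (x', y) = 0 by near: x'.
  rewrite -(g_uniq x' y Xx' _ Fy); last by apply: sY; apply: le_ball yd; exact: ltW.
  by move: yd; rewrite -ball_normE /= => /lt_trans; apply.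
have g_diff x : X x -> is_diff x g (implicit_differential F (x, g x)).
  move=> Xx; have [dF Fy0] := nbhs_singleton (Omega_good _ (Og _ Xx)).
  apply: is_diff_implicit => //; first exact: g_cont.
  by rewrite Fg //; apply: filterS (Xnear _ Xx) => x' /Fg.
exists X, Y, g; split; first by split=> //; exact: ballxx.
move=> x Xx; split; [exact: gY|exact: Fg| |exact: g_cont|exact: g_diff].
by move=> y; exact: g_uniq.
Unshelve. all: by end_near. Qed.
End implicit_function.

Theorem theorem1 (R : realType) (n : nat) (n_ge1 : (1 <= n)%N)
    (Omega : set ('rV[R]_n * R)) (Omega_neq0 : Omega !=set0)
    (Omega_open : open Omega)
    (F : 'rV[R]_n * R -> R)
    (F_diff : forall p, Omega p -> differentiable F p)
    (Fy_neq0 : forall p, Omega p -> partial_y F p <> 0)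
    (a : 'rV[R]_n) (b : R) (Omega_ab : Omega (a, b)) (F_ab : F (a, b) = 0) :
  exists (X : set 'rV[R]_n) (Y : set R),
    open X /\ open Y /\ X `*` Y `<=` Omega /\ (X `*` Y) (a, b) /\
    exists g : 'rV[R]_n -> R,
      implicit_solution F X Y g /\
      (forall h : 'rV[R]_n -> R,
         implicit_solution F X Y h -> forall x, X x -> h x = g x) /\
      g a = b /\
      (forall x, X x -> differentiable g x) /\
      (forall x, X x -> forall j : 'I_n,
         partial g j x = - (partial_x F j (x, g x) / partial_y F (x, g x))) /\
      ({for (a, b), continuous (gradient_xy F)} ->
       {for a, continuous (gradient g)}).
Proof.
have [X [Y [g [[X_open Y_open XY_Omega Xa Yb] g_spec]]]] :=
  implicit_function Omega_open F_diff Fy_neq0 Omega_ab F_ab.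
have gab : g a = b by have [_ _ g_uniq _ _] := g_spec _ Xa; exact/esym/g_uniq.
have Og x : X x -> Omega (x, g x).
  by move=> Xx; apply: XY_Omega; split=> //=; have [] := g_spec _ Xx.
have g_partial x : X x -> forall j : 'I_n,
    partial g j x = - (partial_x F j (x, g x) / partial_y F (x, g x)).
  move=> Xx j; have [_ _ _ _ [dg dgE]] := g_spec _ Xx.
  rewrite /partial (deriveE _ dg) dgE /partial_x (deriveE _ (F_diff _ (Og _ Xx))).
  by rewrite mulrC.
exists X, Y; do 4![split => //].
exists g; split; first by split=> [x|x] /g_spec[].
split.
  move=> h [hY Fh] x Xx; have [_ _ g_uniq _ _] := g_spec _ Xx.
  by apply: g_uniq; [exact: hY|exact: Fh].
split=> //; split; first by move=> x /g_spec[_ _ _ _ []].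
split=> // gradF_cont.
(* Near [a], the gradient of [g] is a continuous function of the gradient of [F]
   at [(x, g x)]. *)
have gradgE : \forall x \near a,
    - ((gradient_xy F (x, g x)).2^-1 *: (gradient_xy F (x, g x)).1) = gradient g x.
  apply: filterS (open_nbhs_nbhs (conj X_open Xa)) => x Xx; apply/rowP => j.
  by rewrite !mxE g_partial // mulrC.
apply: cvg_trans; first exact: near_eq_cvg gradgE.
have [_ _ _ /graph_continuous graph_cvg _] := g_spec _ Xa.
rewrite -gab in gradF_cont.
have gradF_cvg : gradient_xy F (x, g x) @[x --> a] --> gradient_xy F (a, g a).
  exact: (cvg_comp _ _ graph_cvg gradF_cont).
rewrite -(nbhs_singleton gradgE).
apply: cvgN; apply: cvgZ; last exact: (cvg_comp _ _ gradF_cvg cvg_fst).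
apply: cvgV; first exact/eqP/Fy_neq0/Og.
exact: (cvg_comp _ _ gradF_cvg cvg_snd).
Qed.
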